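(* Let $0\neq q\in\mathbb{I}$ be an arbitrary icosian. The lattice $\frac{1}{|q\widetilde q|}\,qL\widetilde q$ is commensurate with $L$ if and only if $|q\widetilde q|\in\mathbb{N}$.
   Context: Let $K=\mathbb{Q}(\sqrt5)$, $\tau=(1+\sqrt5)/2$, $\mathfrak{o}=\mathbb{Z}[\tau]$, $\mathbb{N}=\{1,2,3,\dots\}$, and let ${}'$ denote the algebraic conjugation of $K$ induced by $\sqrt5\mapsto-\sqrt5$. Let $\mathbb{H}(K)=K\oplus \mathrm{i}K\oplus \mathrm{j}K\oplus \mathrm{k}K$ be the Hamilton quaternion algebra over $K$ ($\mathrm{i}^2=\mathrm{j}^2=\mathrm{k}^2=\mathrm{ijk}=-1$), with elements written $q=(a,b,c,d)=a+\mathrm{i}b+\mathrm{j}c+\mathrm{k}d$. The norm $|q|$ is the Euclidean length, $|q|^2=q\bar q$ with $\bar q=(a,-b,-c,-d)$. The twist map is $\widetilde q=(a',b',d',c')$. The icosian ring is $$\mathbb{I}=\big\langle(1,0,0,0),(0,1,0,0),\tfrac12(1,1,1,1),\tfrac12(1-\tau,\tau,0,1)\big\rangle_{\mathfrak{o}},$$ whose elements are called icosians, and $$L=\big\langle(1,0,0,0),\tfrac12(-1,1,1,1),(0,-1,0,0),\tfrac12(0,1,\tau-1,-\tau)\big\rangle_{\mathbb{Z}}\subset\mathbb{I}$$ is a copy of the root lattice $A_4$ in $\mathbb{R}^4$ (quaternions viewed as vectors in $\mathbb{R}^4$). Two lattices in $\mathbb{R}^4$ are commensurate if they share a common (full-rank)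 sublattice. *)

(* Defs.v *)
From HB Require Import structures.
From mathcomp Require Import all_boot all_order all_algebra ring lra.
From mathcomp Require Import classical_sets reals.

Set Implicit Arguments.
Unset Strict Implicit.
Unset Printing Implicit Defensive.

Import Order.TTheory GRing.Theory Num.Theory.
Local Open Scope ring_scope.
Local Open Scope classical_set_scope.

(* [QSqrt5 a b] stands for a + b sqrt 5. *)
Record qsqrt5 := QSqrt5 { q5rat : rat; q5irr : rat }.

Section QSqrt5Field.

Let to_pair (x : qsqrt5) := (q5rat x, q5irr x).
Let of_pair (p : rat * rat) := QSqrt5 p.1 p.2.
Let to_pairK : cancel to_pair of_pair. Proof. by case. Qed.
HB.instance Definition _ := Choice.copy qsqrt5 (can_type to_pairK).

Implicit Types x y z : qsqrt5.

Definition q5zero := QSqrt5 0 0.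
Definition q5one := QSqrt5 1 0.
Definition q5opp x := QSqrt5 (- q5rat x) (- q5irr x).
Definition q5add x y := QSqrt5 (q5rat x + q5rat y) (q5irr x + q5irr y).
Definition q5mul x y :=
  QSqrt5 (q5rat x * q5rat y + 5 * (q5irr x * q5irr y))
         (q5rat x * q5irr y + q5irr x * q5rat y).
Definition q5inv x :=
  let n := q5rat x ^+ 2 - 5 * q5irr x ^+ 2 in
  QSqrt5 (q5rat x / n) (- q5irr x / n).

Let q5addA : associative q5add.
Proof. by move=> x y z; congr QSqrt5; rewrite addrA. Qed.
Let q5addC : commutative q5add.
Proof. by move=> x y; congr QSqrt5; rewrite addrC. Qed.
Let q5add0 : left_id q5zero q5add.
Proof. by case=> a b; congr QSqrt5; rewrite add0r. Qed.
Let q5addN : left_inverse q5zero q5opp q5add.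
Proof. by move=> x; congr QSqrt5; rewrite addNr. Qed.
HB.instance Definition _ :=
  GRing.isZmodule.Build qsqrt5 q5addA q5addC q5add0 q5addN.

Let q5mulA : associative q5mul.
Proof. by move=> x y z; congr QSqrt5 => /=; ring. Qed.
Let q5mulC : commutative q5mul.
Proof. by move=> x y; congr QSqrt5 => /=; ring. Qed.
Let q5mul1 : left_id q5one q5mul.
Proof. by case=> a b; congr QSqrt5 => /=; ring. Qed.
Let q5mulD : left_distributive q5mul +%R.
Proof. by move=> x y z; congr QSqrt5 => /=; ring. Qed.
Let q5one_neq0 : q5one != 0.
Proof. by apply/eqP => -[]. Qed.
HB.instance Definition _ :=
  GRing.Zmodule_isComNzRing.Build qsqrt5
    q5mulA q5mulC q5mul1 q5mulD q5one_neq0.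

Lemma sqr_rat_neq5 (r : rat) : r ^+ 2 != 5.
Proof.
apply/eqP => r2.
have /(congr1 absz) : numq r ^+ 2 = 5 * denq r ^+ 2.
  apply: (@intr_inj rat); rewrite !expr2 !intrM -!expr2.
  have dn0 : (denq r)%:~R != 0 :> rat by rewrite intr_eq0 denq_neq0.
  have <- : r * (denq r)%:~R = (numq r)%:~R.
    by rewrite -{1}(divq_num_den r) divfK.
  by rewrite exprMn r2.
rewrite abszM !abszX => /(congr1 (logn 5)).
have d0 : (0 < `|denq r| ^ 2)%N by rewrite expn_gt0 absz_gt0 denq_neq0.
by rewrite lognM // !lognX => /(congr1 odd); rewrite oddD !oddM.
Qed.

Let q5mulV x : x != 0 -> q5mul (q5inv x) x = 1.
Proof.
case: x => a b x0.
have n0 : a ^+ 2 - 5 * b ^+ 2 != 0.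
  apply: contra x0; rewrite subr_eq0 => /eqP ab.
  have [b0|bn0] := eqVneq b 0; last first.
    by case/eqP: (sqr_rat_neq5 (a / b)); rewrite expr_div_n ab mulfK ?expf_neq0.
  have a0 : a = 0 by apply/eqP; rewrite -sqrf_eq0 ab b0 expr0n mulr0.
  by rewrite a0 b0.
by congr QSqrt5 => /=; field.
Qed.
Let q5inv0 : q5inv 0 = 0.
Proof. by congr QSqrt5; rewrite /= ?oppr0 mul0r. Qed.
HB.instance Definition _ := GRing.ComNzRing_isField.Build qsqrt5 q5mulV q5inv0.

End QSqrt5Field.

Definition sqrt5 : qsqrt5 := QSqrt5 0 1.
Definition tau : qsqrt5 := (1 + sqrt5) / 2.
Definition q5conj (x : qsqrt5) : qsqrt5 := QSqrt5 (q5rat x) (- q5irr x).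
Definition q5real (R : realType) (x : qsqrt5) : R :=
  ratr (q5rat x) + ratr (q5irr x) * Num.sqrt 5.

Definition Ztau : set qsqrt5 :=
  [set x | exists p : {poly int}, x = (map_poly intr p).[tau]].

(* The quaternion a + ib + jc + kd is the row vector (a, b, c, d). *)
Definition quat (F : Type) := 'rV[F]_4.
Definition Quat (F : nzRingType) (a b c d : F) : quat F :=
  \row_(i < 4) [:: a; b; c; d]`_i.

HB.instance Definition _ (F : comNzRingType) := GRing.Lmodule.on (quat F).

Definition qre (F : Type) (q : quat F) : F := q ord0 (@Ordinal 4 0 isT).
Definition qi (F : Type) (q : quat F) : F := q ord0 (@Ordinal 4 1 isT).
Definition qj (F : Type) (q : quat F) : F := q ord0 (@Ordinal 4 2 isT).
Definition qk (F : Type) (q : quat F) : F := q ord0 (@Ordinal 4 3 isT).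

Section QuaternionRing.
Variable F : comNzRingType.
Implicit Types p q r : quat F.

Definition qmul p q : quat F := Quat
  (qre p * qre q - qi p * qi q - qj p * qj q - qk p * qk q)
  (qre p * qi q + qi p * qre q + qj p * qk q - qk p * qj q)
  (qre p * qj q - qi p * qk q + qj p * qre q + qk p * qi q)
  (qre p * qk q + qi p * qj q - qj p * qi q + qk p * qre q).

Lemma quatP p q :
  qre p = qre q -> qi p = qi q -> qj p = qj q -> qk p = qk q -> p = q.
Proof.
move=> h0 h1 h2 h3; apply/rowP => -[[|[|[|[|//]]]] lt4].
- by move: h0; rewrite /qre (bool_irrelevance lt4 isT).
- by move: h1; rewrite /qi (bool_irrelevance lt4 isT).
- by move: h2; rewrite /qj (bool_irrelevance lt4 isT).
- by move: h3; rewrite /qk (bool_irrelevance lt4 isT).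
Qed.

Let qmulA : associative qmul.
Proof.
by move=> p q r; apply: quatP; rewrite /qmul /qre /qi /qj /qk !mxE /=; ring.
Qed.
Let qmul1 : left_id (Quat 1 0 0 0) qmul.
Proof.
by move=> p; apply: quatP; rewrite /qmul /qre /qi /qj /qk !mxE /=; ring.
Qed.
Let qmulr1 : right_id (Quat 1 0 0 0) qmul.
Proof.
by move=> p; apply: quatP; rewrite /qmul /qre /qi /qj /qk !mxE /=; ring.
Qed.
Let qmulDl : left_distributive qmul +%R.
Proof.
by move=> p q r; apply: quatP; rewrite /qmul /qre /qi /qj /qk !mxE /=; ring.
Qed.
Let qmulDr : right_distributive qmul +%R.
Proof.
by move=> p q r; apply: quatP; rewrite /qmul /qre /qi /qj /qk !mxE /=; ring.
Qed.
Let qone_neq0 : Quat 1 0 0 0 != 0 :> quat F.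
Proof.
apply/eqP => /(congr1 (@qre F)); rewrite /qre !mxE /= => /eqP.
by rewrite oner_eq0.
Qed.
HB.instance Definition _ := GRing.Zmodule_isNzRing.Build (quat F)
  qmulA qmul1 qmulr1 qmulDl qmulDr qone_neq0.

End QuaternionRing.

Definition qtwist (q : quat qsqrt5) : quat qsqrt5 :=
  Quat (q5conj (qre q)) (q5conj (qi q)) (q5conj (qk q)) (q5conj (qj q)).

Definition qvec (R : realType) (q : quat qsqrt5) : 'rV[R]_4 :=
  map_mx (q5real R) q.

(* The Euclidean length; the norm which the libraries put on matrices is the
   maximum norm. *)
Definition qnorm (R : realType) (q : quat qsqrt5) : R :=
  Num.sqrt (\sum_i qvec R q 0 i ^+ 2).

Definition icosian_basis : 4.-tuple (quat qsqrt5) :=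
  [tuple Quat 1 0 0 0;
         Quat 0 1 0 0;
         2^-1 *: Quat 1 1 1 1;
         2^-1 *: Quat (1 - tau) tau 0 1].

Definition icosians : set (quat qsqrt5) :=
  [set q | exists c : 'I_4 -> qsqrt5,
     (forall i, Ztau (c i)) /\ q = \sum_i c i *: tnth icosian_basis i].

Definition A4_basis : 4.-tuple (quat qsqrt5) :=
  [tuple Quat 1 0 0 0;
         2^-1 *: Quat (-1) 1 1 1;
         Quat 0 (-1) 0 0;
         2^-1 *: Quat 0 1 (tau - 1) (- tau)].

Definition A4_lattice : set (quat qsqrt5) := [set q | inIntSpan A4_basis q].

Definition is_lattice (R : realType) (G : set 'rV[R]_4) : Prop :=
  exists b : 4.-tuple 'rV[R]_4,
    basis_of fullv b /\ G = [set v | inIntSpan b v].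

Definition commensurate (R : realType) (G H : set 'rV[R]_4) : Prop :=
  exists M : set 'rV[R]_4, [/\ is_lattice M, M `<=` G & M `<=` H].

(* Main.v *)
(** Write N q = q qbar in K. The twist is a semilinear involutive
    anti-automorphism whose fixed space is the Q-span of L, so x |-> q x q~
    preserves QL. With c = |q q~|, c^2 = N q * (N q)' is a rational integer,
    because N q lies in Z[tau] for an icosian q.

    If the lattices are commensurate, some y != 0 in L satisfies c y = q x q~
    with x in L. Comparing entries gives c in K, and applying the twist gives
    c = c'; hence c is rational, and c^2 in Z makes it a natural number.

    Conversely, if c is a natural number, then the preimages
    c^-1 qbar e_i qbar~ of the basis vectors e_i of L are twist-fixed, so they
    lie in QL, and clearing denominators yields m > 0 with m L inside both
    lattices. *)
From HB Require Import structures.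
Require Import Defs.
From mathcomp Require Import all_boot all_order all_algebra.
From mathcomp Require Import ring lra.
From mathcomp Require Import classical_sets reals.

Set Implicit Arguments.
Unset Strict Implicit.
Unset Printing Implicit Defensive.

Import Order.TTheory GRing.Theory Num.Theory.
Local Open Scope ring_scope.
Local Open Scope classical_set_scope.

(** * The real embedding of K and its algebraic conjugation *)

Fact q5real_is_zmod_morphism (R : realType) : zmod_morphism (q5real R).
Proof. by move=> x y; rewrite /q5real !rmorphB /=; ring. Qed.

Fact q5real_is_monoid_morphism (R : realType) : monoid_morphism (q5real R).
Proof.
split=> [|x y]; first by rewrite /q5real rmorph0 rmorph1 mul0r addr0.
have s5 : Num.sqrt 5 * Num.sqrt 5 = 5 :> R by rewrite -expr2 sqr_sqrtr.
case: x y => [a b] [c d]; rewrite /q5real /=.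
rewrite (rmorphD _ (a * c)) (rmorphD _ (a * d)) !(rmorphM ratr) /=.
have r5 : ratr 5 = 5 :> R := ratr_nat R 5.
(* The coefficient 5 is written as the square of [Num.sqrt 5], so that [ring] can treat this root as
   an indeterminate. *)
by rewrite r5 -[X in X * (_ * _)]s5; ring.
Qed.

HB.instance Definition _ (R : realType) :=
  GRing.isZmodMorphism.Build qsqrt5 R (q5real R) (q5real_is_zmod_morphism R).
HB.instance Definition _ (R : realType) :=
  GRing.isMonoidMorphism.Build qsqrt5 R (q5real R)
    (q5real_is_monoid_morphism R).

Fact q5conj_is_zmod_morphism : zmod_morphism q5conj.
Proof. by move=> x y; congr QSqrt5; rewrite /= opprD. Qed.

Fact q5conj_is_monoid_morphism : monoid_morphism q5conj.
Proof. by split=> [|x y]; congr QSqrt5 => //=; ring. Qed.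

HB.instance Definition _ :=
  GRing.isZmodMorphism.Build qsqrt5 qsqrt5 q5conj q5conj_is_zmod_morphism.
HB.instance Definition _ :=
  GRing.isMonoidMorphism.Build qsqrt5 qsqrt5 q5conj
    q5conj_is_monoid_morphism.

(** * Arithmetic and norms in Z[tau] *)

Lemma q5conjK : involutive q5conj.
Proof. by case=> a b; rewrite /q5conj opprK. Qed.

Lemma q5_natr n : n%:R = QSqrt5 n%:R 0.
Proof. by elim: n => // n IH; rewrite -!natr1 IH; congr QSqrt5. Qed.

Lemma q5_intr (m : int) : m%:~R = QSqrt5 m%:~R 0.
Proof.
case: m => n; first exact: q5_natr.
by rewrite NegzE !rmorphN /= -!pmulrn q5_natr; congr QSqrt5; rewrite oppr0.
Qed.

Lemma q5_half : 2^-1 = QSqrt5 (1 / 2) 0.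
Proof. by congr QSqrt5. Qed.

Lemma tauE : tau = QSqrt5 (1 / 2) (1 / 2).
Proof. by congr QSqrt5. Qed.

Lemma tau_sqr : tau * tau = tau + 1.
Proof. by rewrite tauE; congr QSqrt5. Qed.

Lemma q5conj_tau : q5conj tau = 1 - tau.
Proof. by rewrite tauE; congr QSqrt5. Qed.

Lemma ZtauP x : Ztau x <-> exists m n : int, x = m%:~R + n%:~R * tau.
Proof.
split=> [[p ->] | [m [n ->]]]; last first.
  by exists (m%:P + n%:P * 'X); rewrite rmorphD rmorphM /= !map_polyC map_polyX
    /= hornerD hornerM !hornerC hornerX.
elim/poly_ind: p => [|p c [m [n IH]]].
  by exists 0, 0; rewrite rmorph0 horner0 mul0r addr0.
(* Horner step: (m + n tau) tau + c = (n + c) + (m + n) tau, because tau^2 = tau + 1. *)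
exists (n + c), (m + n).
rewrite rmorphD rmorphM /= map_polyC map_polyX /= hornerD hornerM hornerC.
by rewrite hornerX IH mulrDl -mulrA tau_sqr !rmorphD /=; ring.
Qed.

Lemma ZtauD x y : Ztau x -> Ztau y -> Ztau (x + y).
Proof. by move=> [p ->] [r ->]; exists (p + r); rewrite rmorphD hornerD. Qed.

Lemma ZtauM x y : Ztau x -> Ztau y -> Ztau (x * y).
Proof. by move=> [p ->] [r ->]; exists (p * r); rewrite rmorphM hornerM. Qed.

Lemma Ztau1Btau : Ztau (1 - tau).
Proof. by apply/ZtauP; exists 1, (-1); rewrite rmorphN1 mulN1r. Qed.

Lemma Ztau_tau : Ztau tau.
Proof. by exists 'X; rewrite map_polyX hornerX. Qed.

(** Since tau + tau' = 1 and tau tau' = -1, the norm of m + n tau is the integral form m^2 + mn -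
    n^2. *)
Lemma Ztau_norm x : Ztau x -> exists z : int, x * q5conj x = z%:~R.
Proof.
move=> /ZtauP[m [n ->]]; exists (m * m + m * n - n * n).
rewrite rmorphD rmorphM /= q5conj_tau !rmorph_int.
rewrite rmorphB rmorphD !rmorphM /=.
transitivity (m%:~R * m%:~R + m%:~R * n%:~R
  + n%:~R * n%:~R * (tau - tau * tau) : qsqrt5); first by ring.
by rewrite tau_sqr; ring.
Qed.

(** * Quaternion conjugation and reduced norm *)

Section Quaternions.
Variable F : comNzRingType.
Implicit Types (p q : quat F) (k : F).

Definition qbar p : quat F := Quat (qre p) (- qi p) (- qj p) (- qk p).
(** The reduced norm, with values in [F] itself; over K its real image is the squared Euclidean
    length. *)
Definition qsq p : F := qre p ^+ 2 + qi p ^+ 2 + qj p ^+ 2 + qk p ^+ 2.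

Lemma quatM p q : p * q = qmul p q. Proof. by []. Qed.
Lemma quat1 : 1 = Quat 1 0 0 0 :> quat F. Proof. by []. Qed.

Lemma qscaleAl k p q : k *: (p * q) = (k *: p) * q.
Proof.
by apply: quatP; rewrite !quatM /qmul /qre /qi /qj /qk !mxE /=; ring.
Qed.

Lemma qscaleAr k p q : k *: (p * q) = p * (k *: q).
Proof.
by apply: quatP; rewrite !quatM /qmul /qre /qi /qj /qk !mxE /=; ring.
Qed.

Lemma qmul_bar p : p * qbar p = qsq p *: (1 : quat F).
Proof.
by apply: quatP;
  rewrite !quatM quat1 /qsq /qbar /qmul /qre /qi /qj /qk !mxE /=; ring.
Qed.

Lemma qbar_mul p : qbar p * p = qsq p *: (1 : quat F).
Proof.
by apply: quatP;
  rewrite !quatM quat1 /qsq /qbar /qmul /qre /qi /qj /qk !mxE /=; ring.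
Qed.

(** This is Euler's four-square identity, valid over any commutative ring. *)
Lemma qsqM p q : qsq (p * q) = qsq p * qsq q.
Proof.
by rewrite !quatM /qsq /qbar /qmul /qre /qi /qj /qk !mxE /=; ring.
Qed.

End Quaternions.

(** * The twist map and the norms of icosians *)

(** Fixing i and exchanging j with k reverses products (ij = k becomes ki = j), while the
    conjugation of the entries respects them. *)
Lemma qtwistM p q : qtwist (p * q) = qtwist q * qtwist p.
Proof.
by apply: quatP; rewrite !quatM /qtwist /qmul /qre /qi /qj /qk !mxE /=
  !(rmorphD, rmorphB, rmorphM) /=; ring.
Qed.

Lemma qtwistZ k q : qtwist (k *: q) = q5conj k *: qtwist q.
Proof.
by apply: quatP; rewrite /qtwist /qre /qi /qj /qk !mxE /= rmorphM.
Qed.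

Lemma qtwistK : involutive qtwist.
Proof.
by move=> q; apply: quatP; rewrite /qtwist /qre /qi /qj /qk !mxE /= q5conjK.
Qed.

Lemma qtwist_bar q : qtwist (qbar q) = qbar (qtwist q).
Proof.
by apply: quatP; rewrite /qtwist /qbar /qre /qi /qj /qk !mxE /= ?rmorphN.
Qed.

Lemma qsq_twist q : qsq (qtwist q) = q5conj (qsq q).
Proof.
by rewrite /qsq /qtwist /qre /qi /qj /qk !mxE /= !(rmorphD, rmorphXn) /=; ring.
Qed.

Lemma qnormE (R : realType) q : qnorm R q = Num.sqrt (q5real R (qsq q)).
Proof.
rewrite /qnorm !big_ord_recl big_ord0 addr0 !mxE /qsq !(rmorphD, rmorphXn) /=.
rewrite !addrA /qre /qi /qj /qk.
by congr (Num.sqrt (_ ^+ 2 + _ ^+ 2 + _ ^+ 2 + _ ^+ 2));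
  congr (q5real R (q _ _)); apply: val_inj.
Qed.

(** In the icosian basis the reduced norm is a quadratic form over Z[tau]: each basis vector has
    norm 1, and twice each inner product lies in Z[tau]. *)
Lemma icosian_qsq q : icosians q -> Ztau (qsq q).
Proof.
move=> [c [cZ ->]].
set c0 := c ord0; set c1 := c (lift ord0 ord0).
set c2 := c (lift ord0 (lift ord0 ord0)).
set c3 := c (lift ord0 (lift ord0 (lift ord0 ord0))).
have two0 : 2 != 0 :> qsqrt5 by apply/eqP => -[].
have -> : qsq (\sum_i c i *: tnth icosian_basis i) =
  c0 * c0 + c1 * c1 + c2 * c2 + c3 * c3 + c0 * c2 + c0 * c3 * (1 - tau)
  + c1 * c2 + c1 * c3 * tau + c2 * c3.
  rewrite !big_ord_recl big_ord0 addr0 -/c0 -/c1 -/c2 -/c3.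
  rewrite /qsq /qre /qi /qj /qk !mxE /=.
  apply: (mulIf two0); apply: (mulIf two0).
  transitivity ((c0 * c0 + c1 * c1 + c2 * c2 + c3 * c3 + c0 * c2
    + c0 * c3 * (1 - tau) + c1 * c2 + c1 * c3 * tau + c2 * c3) * 2 * 2
    (* Only the coefficient of c3^2 needs the relation for tau: (1 - tau)^2 + tau^2 + 1 equals 4
       modulo tau^2 - tau - 1. *)
    + 2 * c3 * c3 * (tau * tau - tau - 1)); first by field.
  by rewrite tau_sqr; ring.
by do ![exact: cZ | exact: Ztau1Btau | exact: Ztau_tau | apply: ZtauD
  | apply: ZtauM].
Qed.

(** * The lattice L inside the twist-fixed space *)

Fact qtwist_is_zmod_morphism : zmod_morphism qtwist.
Proof.
by move=> p q; apply: quatP; rewrite /qtwist /qre /qi /qj /qk !mxE /= rmorphB.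
Qed.
HB.instance Definition _ :=
  GRing.isZmodMorphism.Build (quat qsqrt5) (quat qsqrt5) qtwist
    qtwist_is_zmod_morphism.

(** Only the fourth vector has irrational entries; they are swapped back by the twist because (tau -
    1)' = -tau. *)
Lemma qtwist_A4_basis (i : 'I_4) : qtwist A4_basis`_i = A4_basis`_i.
Proof.
by case: i => -[|[|[|[|//]]]] lti /=; apply: quatP;
  rewrite /qtwist /qre /qi /qj /qk !mxE /= ?tauE; congr QSqrt5.
Qed.

Lemma qtwist_A4 x : A4_lattice x -> qtwist x = x.
Proof.
move=> [a ->]; rewrite raddf_sum; apply: eq_bigr => i _.
by rewrite raddfMz /= qtwist_A4_basis.
Qed.

Lemma common_denominator (I : finType) (r : I -> rat) :
  exists m : nat, exists n : I -> int,
    (0 < m)%N /\ forall i, r i * m%:R = (n i)%:~R.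
Proof.
exists (\prod_i `|denq (r i)|)%N.
exists (fun i => numq (r i) * (\prod_(j | j != i) `|denq (r j)|)%N).
split=> [|i]; first by apply: prodn_gt0 => i; rewrite absz_gt0 denq_neq0.
rewrite (bigD1 i) //= natrM mulrA intrM; congr (_ * _).
have -> : `|denq (r i)|%N%:R = (denq (r i))%:~R :> rat.
  by rewrite pmulrn gez0_abs // denq_ge0.
by rewrite -{1}(divq_num_den (r i)) divfK // intr_eq0 denq_neq0.
Qed.

(** Being fixed makes the first two entries rational and the last two conjugate, leaving four
    rational parameters, as many as L has basis vectors. *)
Lemma twist_fixed_A4 y :
  qtwist y = y -> exists2 m : nat, (0 < m)%N & A4_lattice (y *+ m).
Proof.
move=> yT.
have yE : exists r : 'I_4 -> rat, y = \sum_i QSqrt5 (r i) 0 *: tnth A4_basis i.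
  case Ea : (qre y) => [a a']; case Eb : (qi y) => [b b'].
  case Ec : (qj y) => [u v]; case Ed : (qk y) => [d d'].
  (* These coefficients solve the linear system for y = (a, b, u + v sqrt 5, u - v sqrt 5) in the
     basis of L. *)
  exists (fun i : 'I_4 =>
    [:: a + u + v; 2 * (u + v); u + 3 * v - b; 4 * v]`_i).
  move/(congr1 (@qre _)): (yT); rewrite {1}/qtwist.
  rewrite !big_ord_recl big_ord0 addr0 /=.
  rewrite {1}/qre mxE /= Ea => -[aE].
  move/(congr1 (@qi _)): (yT); rewrite {1}/qtwist {1}/qi mxE /= Eb => -[bE].
  move/(congr1 (@qj _)): (yT); rewrite {1}/qtwist {1}/qj mxE /= Ec Ed
    => -[cE dE].
  have [a0 b0] : a' = 0 /\ b' = 0 by split; lra.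
  by apply: quatP; rewrite ?Ea ?Eb ?Ec ?Ed /qre /qi /qj /qk !mxE /= ?mxE /=;
    rewrite ?tauE ?q5_half; congr QSqrt5 => /=; lra.
have [r ->] := yE; have [m [n [m0 rn]]] := common_denominator r.
exists m => //.
exists [ffun i => n i].
rewrite -sumrMnl; apply: eq_bigr => i _; rewrite ffunE (tnth_nth 0).
rewrite -scaler_int -scaler_nat scalerA q5_natr q5_intr; congr (_ *: _).
by congr QSqrt5; rewrite /= ?mulr0 ?mul0r ?addr0 // mulrC rn.
Qed.

(** * Integral spans and rational square roots of integers *)

Lemma inIntSpan_sum (V : zmodType) m (s : m.-tuple V) (I : finType)
    (f : I -> V) (a : I -> int) :
  (forall i, inIntSpan s (f i)) -> inIntSpan s (\sum_i f i *~ a i).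
Proof.
move=> /fin_all_exists[g fE].
exists [ffun j => \sum_i g i j * a i].
under eq_bigr => i _ do rewrite fE mulrz_suml.
rewrite exchange_big; apply: eq_bigr => j _.
by rewrite ffunE mulrz_sumr; apply: eq_bigr => i _; rewrite mulrzA.
Qed.

(** The squared denominator divides the squared numerator, so by coprimality the denominator is
    1. *)
Lemma rat_sqr_int (r : rat) (z : int) :
  0 < r -> r ^+ 2 = z%:~R -> exists n : nat, (0 < n)%N /\ r = n%:R.
Proof.
move=> r0 r2.
have dn0 : (denq r)%:~R != 0 :> rat by rewrite intr_eq0 denq_neq0.
have rE : r * (denq r)%:~R = (numq r)%:~R.
  by rewrite -{1}(divq_num_den r) divfK.
have /(congr1 absz) : numq r ^+ 2 = z * denq r ^+ 2.
  apply: (@intr_inj rat); rewrite !expr2 !intrM -!expr2.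
  by rewrite -rE exprMn r2.
rewrite abszM !abszX => nd.
have : (`|denq r| ^ 2 %| `|numq r| ^ 2)%N by rewrite nd dvdn_mull.
rewrite dvdn_pexp2r // => dn.
have d1 : `|denq r|%N = 1%N.
  by apply/eqP; rewrite -dvdn1 -(eqP (coprime_num_den r)) dvdn_gcd dn dvdnn.
exists `|numq r|%N.
have d1' : denq r = 1 by rewrite -(gez0_abs (denq_ge0 r)) d1.
have rE' : r = (numq r)%:~R by rewrite -rE d1' mulr1.
have n0 : 0 < numq r by rewrite numq_gt0.
split; first by rewrite absz_gt0 gt_eqF.
by rewrite {1}rE' pmulrn gtz0_abs.
Qed.

(** * Passage to vectors in real 4-space *)

Section RealEmbedding.
Variable R : realType.

Lemma qvecZ (k : qsqrt5) (q : quat qsqrt5) :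
  qvec R (k *: q) = q5real R k *: qvec R q.
Proof. by apply/rowP => i; rewrite !mxE rmorphM. Qed.

Lemma qvec_inj : injective (qvec R).
Proof. exact: (@map_mx_inj _ _ (q5real R)). Qed.

Lemma qvec_sumz (I : finType) (f : I -> quat qsqrt5) (a : I -> int) :
  qvec R (\sum_i f i *~ a i) = \sum_i qvec R (f i) *~ a i.
Proof.
rewrite /qvec raddf_sum; apply: eq_bigr => i _; exact: raddfMz.
Qed.

Lemma qsq_real_ge0 q : 0 <= q5real R (qsq q).
Proof. by rewrite /qsq !(rmorphD, rmorphXn) /= !addr_ge0 ?sqr_ge0. Qed.

(** Definiteness comes from the order of the reals, through the injective real embedding. *)
Lemma qsq_neq0 (q : quat qsqrt5) : q != 0 -> qsq q != 0.
Proof.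
apply: contra; rewrite -(fmorph_eq0 (q5real R)) /qsq !(rmorphD, rmorphXn) /=.
rewrite !paddr_eq0 ?addr_ge0 ?sqr_ge0 // !sqrf_eq0 !fmorph_eq0.
move=> /andP[/andP[/andP[/eqP a0 /eqP b0] /eqP c0] /eqP d0].
by apply/eqP/quatP; rewrite ?a0 ?b0 ?c0 ?d0 /qre /qi /qj /qk mxE.
Qed.

Lemma qvec_Quat a b c d :
  qvec R (Quat a b c d)
  = Quat (q5real R a) (q5real R b) (q5real R c) (q5real R d).
Proof. by apply/rowP => -[[|[|[|[|//]]]] lti]; rewrite !mxE. Qed.

Lemma qvec_A4_basis (t := q5real R tau) :
  [seq qvec R e | e <- A4_basis] =
  [:: Quat 1 0 0 0; 2^-1 *: Quat (-1) 1 1 1; Quat 0 (-1) 0 0;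
      2^-1 *: Quat 0 1 (t - 1) (- t)].
Proof.
have r0 : q5real R 0 = 0 := rmorph0 _.
have r1 : q5real R 1 = 1 := rmorph1 _.
have rN1 : q5real R (-1) = -1 := rmorphN1 _.
have rN : q5real R (- tau) = - t := rmorphN _ _.
have rB : q5real R (tau - 1) = t - 1 by rewrite rmorphB rmorph1.
have rV : q5real R 2^-1 = 2^-1 by rewrite fmorphV rmorph_nat.
by rewrite /= !qvecZ !qvec_Quat rV r0 r1 rN1 rN rB.
Qed.

Lemma A4_free : free [seq qvec R e | e <- A4_basis].
Proof.
rewrite qvec_A4_basis; set t := q5real R tau.
have tt : t * t = t + 1.
  by rewrite -rmorphM /= tau_sqr rmorphD rmorph1.
apply/(@freeP _ _ 4 [tuple _; _; _; _]) => k k0.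
set k0' := k ord0; set k1 := k (lift ord0 ord0).
set k2 := k (lift ord0 (lift ord0 ord0)).
set k3 := k (lift ord0 (lift ord0 (lift ord0 ord0))).
move: k0; rewrite !big_ord_recl big_ord0 addr0 -/k0' -/k1 -/k2 -/k3 /= => E.
have := congr1 (@qk R) E; have := congr1 (@qj R) E.
have := congr1 (@qi R) E; have := congr1 (@qre R) E.
rewrite /qre /qi /qj /qk !mxE /= => e0 e1 e2 e3.
(* The difference of the j- and k-equations is k3 (2t - 1) / 2 = 0; here 2t - 1 is the image of sqrt
   5, and t = 1/2 would contradict t^2 = t + 1. *)
have t0 : 2 * t - 1 != 0.
  apply/eqP => t0; have tE : t = 1 / 2 by lra.
  by move: tt; rewrite tE; lra.
have k30 : k3 = 0 by apply: (mulIf t0); rewrite mul0r; lra.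
rewrite k30 in e0 e1 e2 e3.
have k10 : k1 = 0 by lra.
rewrite k10 in e0 e1 e2 e3.
have k00 : k0' = 0 by lra.
have k20 : k2 = 0 by lra.
by case=> -[|[|[|[|//]]]] lti; [move: k00 | move: k10 | move: k20 | move: k30];
  move=> kE; rewrite -[RHS]kE; congr k; apply: val_inj.
Qed.

Lemma A4_scaled_basis (a : R) :
  a != 0 -> basis_of fullv [tuple a *: qvec R A4_basis`_i | i < 4].
Proof.
move=> a0; rewrite basisEfree subvf dimvf dim_matrix size_tuple leqnn !andbT.
apply/freeP => k k0 i.
have /(@freeP _ _ 4 [tuple of [seq qvec R e | e <- A4_basis]]) fr := A4_free.
apply: (mulIf a0); rewrite mul0r; apply: (fr (fun i => k i * a)).
rewrite -[RHS]k0; apply: eq_bigr => j _.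
by rewrite -scalerA nth_mktuple (nth_map 0) ?size_tuple.
Qed.

Lemma qnorm_sqr (q : quat qsqrt5) : qnorm R q ^+ 2 = q5real R (qsq q).
Proof. by rewrite qnormE sqr_sqrtr ?qsq_real_ge0. Qed.

Lemma qnorm_gt0 (q : quat qsqrt5) : q != 0 -> 0 < qnorm R q.
Proof.
by move=> q0; rewrite qnormE sqrtr_gt0 lt_def qsq_real_ge0 fmorph_eq0 qsq_neq0.
Qed.

Lemma qsq_mul_twist (q : quat qsqrt5) :
  qsq (q * qtwist q) = qsq q * q5conj (qsq q).
Proof. by rewrite qsqM qsq_twist. Qed.

Lemma qmul_twist_neq0 (q : quat qsqrt5) : q != 0 -> q * qtwist q != 0.
Proof.
move=> q0; have : qsq (q * qtwist q) != 0.
  by rewrite qsq_mul_twist; apply: mulf_neq0; rewrite ?fmorph_eq0 qsq_neq0.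
apply: contra => /eqP ->.
by rewrite /qsq /qre /qi /qj /qk !mxE expr0n /= !addr0.
Qed.

Lemma twist_fixed_ratio (c : R) (w y : quat qsqrt5) :
  qtwist w = w -> qtwist y = y -> y != 0 -> qvec R w = c *: qvec R y ->
  exists r : rat, c = ratr r.
Proof.
move=> wT yT y0 wE.
have [i yi0] : exists i, y 0 i != 0.
  by apply/existsP; apply: contraNT y0; rewrite negb_exists => /forallP y0;
    apply/eqP/rowP => i; apply/eqP; move: (y0 i); rewrite negbK mxE.
set k := w 0 i / y 0 i.
have ck : c = q5real R k.
  have := congr1 (fun v : 'rV[R]_4 => v 0 i) wE; rewrite !mxE => wi.
  by rewrite rmorphM fmorphV /= wi mulfK ?fmorph_eq0.
have wk : w = k *: y by apply: qvec_inj; rewrite wE qvecZ ck.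
(* Twisting w = k y gives w = k' y by semilinearity. *)
have : q5conj k *: y = k *: y by rewrite -{1}yT -qtwistZ -wk wT.
move=> /rowP/(_ i); rewrite !mxE => /(mulIf yi0) kk.
exists (q5rat k); rewrite ck; case: (k) kk => a b [bN].
have -> : b = 0 by lra.
by rewrite /q5real /= rmorph0 mul0r addr0.
Qed.

End RealEmbedding.

(** * The commensurability criterion *)

Theorem corollary1 (R : realType) (q : quat qsqrt5) (hq : icosians q)
    (hq0 : q <> 0) :
  commensurate
    [set (1 / qnorm R (q * qtwist q)) *: qvec R (q * x * qtwist q)
      | x in A4_lattice]
    (qvec R @` A4_lattice)
  <-> exists n : nat, (0 < n)%N /\ qnorm R (q * qtwist q) = n%:R.
Proof.
have q0 : q != 0 by apply/eqP.
set c := qnorm R (q * qtwist q).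
have c0 : 0 < c by rewrite qnorm_gt0 ?qmul_twist_neq0.
have [z zE] := Ztau_norm (icosian_qsq hq).
have c2 : c ^+ 2 = z%:~R.
  by rewrite qnorm_sqr qsq_mul_twist zE rmorph_int.
split=> [[M [[b [bB ->]] M1 M2]] | [n [n0 cn]]].
  (* A basis vector of the common sublattice serves as a nonzero vector of both lattices. *)
  have Mb : [set v | inIntSpan b v] b`_0.
    exists [ffun i => (i == 0)%:Z].
    rewrite (bigD1 0) //= big1 ?addr0 ?ffunE ?mulr1z //.
    by move=> i /negPf i0; rewrite ffunE i0 mulr0z.
  have b0 : b`_0 != 0.
    by apply: (free_not0 (basis_free bB)); rewrite mem_nth ?size_tuple.
  have [x Lx xE] := M1 _ Mb; have [y Ly yE] := M2 _ Mb.
  have xT := qtwist_A4 Lx; have yT := qtwist_A4 Ly.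
  have y0 : y != 0.
    by apply: contra b0 => /eqP y0; rewrite -yE y0 /qvec map_mx0.
  have [r rE] : exists r : rat, c = ratr r.
    apply: (@twist_fixed_ratio _ c (q * x * qtwist q) y) => //.
      by rewrite !qtwistM qtwistK xT mulrA.
    by rewrite yE -xE scalerA mulrC mul1r mulVf ?scale1r // gt_eqF.
  have r0 : 0 < r by rewrite -(ltr0q R) -rE.
  have r2 : r ^+ 2 = z%:~R.
    by apply: (fmorph_inj (@ratr R)); rewrite rmorphXn /= -rE c2 rmorph_int.
  have [n [n0 rn]] := rat_sqr_int r0 r2.
  by exists n; split=> //; rewrite rE rn ratr_nat.
(* The value of c^2 is known in the reals; injectivity of the embedding transfers it to K. *)
have n2 : n%:R ^+ 2 = qsq q * qsq (qtwist q).
  apply: (fmorph_inj (q5real R)).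
  by rewrite rmorphXn /= rmorph_nat -cn qnorm_sqr qsqM.
have nK0 : n%:R != 0 :> qsqrt5.
  by rewrite -(fmorph_eq0 (q5real R)) rmorph_nat -cn gt_eqF.
pose x (i : 'I_4) :=
  n%:R^-1 *: (qbar q * A4_basis`_i * qbar (qtwist q)).
have xT i : qtwist (x i) = x i.
  rewrite qtwistZ !qtwistM qtwist_bar qtwistK qtwist_A4_basis qtwist_bar mulrA.
  by rewrite fmorphV rmorph_nat.
have qxq i : q * x i * qtwist q = n%:R *: A4_basis`_i.
  (* Both products with conjugates are central scalars; their product n^2 times n^-1 leaves n. *)
  rewrite /x -qscaleAr -qscaleAl !mulrA qmul_bar -!mulrA qbar_mul.
  rewrite -!qscaleAr -!qscaleAl mulr1 mul1r !scalerA.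
  by congr (_ *: _); rewrite -mulrA [qsq (qtwist q) * _]mulrC -n2 expr2 mulKf.
have [m mP] : exists m : 'I_4 -> nat,
    forall i, (0 < m i)%N /\ A4_lattice (x i *+ m i).
  apply: (fin_all_exists
    (P := fun i (mi : nat) => (0 < mi)%N /\ A4_lattice (x i *+ mi))) => i.
  by have [mi mi0 Li] := twist_fixed_A4 (xT i); exists mi.
pose p := (\prod_i m i)%N.
have p0 : (0 < p)%N by apply: prodn_gt0 => i; case: (mP i).
(* The common sublattice is p L, with p a multiple of every [m i]. *)
exists [set v | inIntSpan [tuple (p%:R : R) *: qvec R A4_basis`_i | i < 4] v].
split.
- have pR : p%:R != 0 :> R by rewrite pnatr_eq0 -lt0n.
  by eexists; split; [exact: A4_scaled_basis pR|].
- move=> v [a ->].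
  (* The vector p e_i is the image of p x_i, which is p / m_i times the element m_i x_i of L; the
     division is exact. *)
  exists (\sum_i (x i *+ m i) *~ ((p %/ m i)%N%:Z * a i)).
    by apply: inIntSpan_sum => i; case: (mP i).
  have -> : q * (\sum_i (x i *+ m i) *~ ((p %/ m i)%N%:Z * a i)) * qtwist q =
      \sum_(i < 4) (n%:R *: A4_basis`_i) *~ (p%:Z * a i).
    rewrite mulr_sumr mulr_suml; apply: eq_bigr => i _.
    rewrite mulrzAr mulrzAl mulrnAr mulrnAl qxq pmulrn -mulrzA mulrA -PoszM.
    by rewrite mulnC divnK // /p (bigD1 i) //= dvdn_mulr.
  rewrite qvec_sumz scaler_sumr; apply: eq_bigr => i _.
  rewrite nth_mktuple qvecZ rmorph_nat -cn -scalerMzr scalerA mul1r.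
  by rewrite mulVf ?gt_eqF // scale1r mulrzA -pmulrn scaler_nat.
- move=> v [a ->].
  exists (\sum_(i < 4) A4_basis`_i *~ (p%:Z * a i)).
    by exists [ffun i => p%:Z * a i]; apply: eq_bigr => i _; rewrite ffunE.
  rewrite qvec_sumz; apply: eq_bigr => i _.
  by rewrite nth_mktuple mulrzA -pmulrn scaler_nat.
Qed.
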